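(* For every rational word $x$ there exist an integer $n\ge 0$, rational prime words $u_1 >_{lex} u_2 >_{lex} \cdots >_{lex} u_n$, and ordinals $\alpha_1,\dots,\alpha_n$ less than $\omega^\omega$ such that $x = u_1^{\alpha_1}\cdots u_n^{\alpha_n}$.
   Context: $A$ is a finite alphabet with a linear order $<_A$. A word is a sequence of letters indexed by a countable ordinal (its length); $x^\alpha$ denotes the concatenation of $\alpha$ copies of $x$. Write $x<_{str}x'$ if there are letters $a<_A b$ and words $y,z,z'$ with $x=yaz$, $x'=ybz'$; the lexicographic order is $x\le_{lex}x'$ iff $x$ is a prefix of $x'$ or $x<_{str}x'$. A word $x$ is primitive if $x=y^\alpha$ implies $\alpha=1$ and $y=x$. A word $w$ is prime if it is primitive and every proper suffix $z$ of $w$ (i.e. $z=w[\gamma,|w|)$ with $0<\gamma<|w|$) satisfies $w\le_{lex}z$. The class of rational words is the smallest class of words containing the empty word and the single letters and closed under concatenation $(u,v)\mapsto uv$ and $\omega$-iteration $u\mapsto u^\omega$. *)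

(* Defs.v *)
(* Transfinite words are modelled as labelled (countable,
   well-ordered) index structures; equality of words is isomorphism of
   labelled orders (= literal equality of ordinal-indexed sequences). *)
From Stdlib Require Import List Sorted.
Import ListNotations.
Set Implicit Arguments.

Record ord := Ord { ocar : Type; olt : ocar -> ocar -> Prop }.

Definition is_countable_wo (o : ord) : Prop :=
  (forall x y z, olt o x y -> olt o y z -> olt o x z) /\
  (forall x, ~ olt o x x) /\
  (forall x y, olt o x y \/ x = y \/ olt o y x) /\
  well_founded (olt o) /\
  (exists f : ocar o -> nat, forall x y, f x = f y -> x = y).

Definition oeq (a b : ord) : Prop :=
  exists (f : ocar a -> ocar b) (g : ocar b -> ocar a),
    (forall x, g (f x) = x) /\ (forall y, f (g y) = y) /\
    (forall x y, olt a x y <-> olt b (f x) (f y)).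

Definition ord_one : ord := @Ord unit (fun _ _ => False).

Definition ord_le (a b : ord) : Prop :=
  exists f : ocar a -> ocar b,
    (forall x y, olt a x y <-> olt b (f x) (f y)) /\
    (forall x z, olt b z (f x) -> exists y, f y = z).

Fixpoint lexlist (l m : list nat) : Prop :=
  match l, m with
  | a :: l', b :: m' => a < b \/ (a = b /\ lexlist l' m')
  | _, _ => False
  end.

Definition omega_pow (n : nat) : ord :=
  @Ord {l : list nat | length l = n} (fun l m => lexlist (proj1_sig l) (proj1_sig m)).

(* alpha < omega^omega  iff  alpha <= omega^n for some n  (omega^omega = sup omega^n) *)
Definition lt_omega_omega (a : ord) : Prop := exists n, ord_le a (omega_pow n).

Definition finite_type (A : Type) : Prop := exists l : list A, forall a, In a l.

Definition strict_total_order (A : Type) (ltA : A -> A -> Prop) : Prop :=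
  (forall a b c, ltA a b -> ltA b c -> ltA a c) /\
  (forall a, ~ ltA a a) /\
  (forall a b, ltA a b \/ a = b \/ ltA b a).

Section Words.
Variable A : Type.

Record word := Word { wcar : Type; wlt : wcar -> wcar -> Prop; wlab : wcar -> A }.

Definition word_ord (w : word) : ord := @Ord (wcar w) (@wlt w).

Definition is_word (w : word) : Prop := is_countable_wo (word_ord w).

Definition weq (u v : word) : Prop :=
  exists (f : wcar u -> wcar v) (g : wcar v -> wcar u),
    (forall x, g (f x) = x) /\ (forall y, f (g y) = y) /\
    (forall x y, wlt u x y <-> wlt v (f x) (f y)) /\
    (forall x, wlab v (f x) = wlab u x).

Definition wempty : word := Word (fun (_ _ : Empty_set) => False) (fun e => match e with end).

Definition wletter (a : A) : word := Word (fun (_ _ : unit) => False) (fun _ => a).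

Definition concat_lt (u v : word) (p q : wcar u + wcar v) : Prop :=
  match p, q with
  | inl x, inl y => wlt u x y
  | inr x, inr y => wlt v x y
  | inl _, inr _ => True
  | inr _, inl _ => False
  end.

Definition concat (u v : word) : word :=
  Word (concat_lt u v)
       (fun p => match p with inl x => wlab u x | inr y => wlab v y end).

Definition womega (u : word) : word :=
  Word (fun (p q : nat * wcar u) => fst p < fst q \/ (fst p = fst q /\ wlt u (snd p) (snd q)))
       (fun p => wlab u (snd p)).

Definition wpow (u : word) (a : ord) : word :=
  Word (fun (p q : ocar a * wcar u) =>
          olt a (fst p) (fst q) \/ (fst p = fst q /\ wlt u (snd p) (snd q)))
       (fun p => wlab u (snd p)).

Fixpoint wprod (l : list (word * ord)) : word :=
  match l with
  | [] => wempty
  | (u, a) :: t => concat (wpow u a) (wprod t)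
  end.

Definition wsuffix (w : word) (g : wcar w) : word :=
  Word (fun (i j : {i : wcar w | ~ wlt w i g}) => wlt w (proj1_sig i) (proj1_sig j))
       (fun i => wlab w (proj1_sig i)).

Variable ltA : A -> A -> Prop.

Definition str_lt (x x' : word) : Prop :=
  exists (y z z' : word) (a b : A),
    is_word y /\ is_word z /\ is_word z' /\ ltA a b /\
    weq x (concat y (concat (wletter a) z)) /\
    weq x' (concat y (concat (wletter b) z')).

Definition wprefix (x x' : word) : Prop :=
  exists z : word, is_word z /\ weq x' (concat x z).

Definition lex_le (x x' : word) : Prop := wprefix x x' \/ str_lt x x'.

Definition lex_gt (u v : word) : Prop := lex_le v u /\ ~ weq u v.

Definition primitive (x : word) : Prop :=
  forall (y : word) (a : ord), is_word y -> is_countable_wo a ->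
    weq x (wpow y a) -> oeq a ord_one /\ weq y x.

(* proper suffixes: gamma an index of w (gamma < |w|) that is not the first one (0 < gamma) *)
Definition prime (w : word) : Prop :=
  primitive w /\
  forall g : wcar w, (exists i, wlt w i g) -> lex_le w (wsuffix w g).

Inductive rexp : Type :=
  | RE : rexp
  | RL : A -> rexp
  | RC : rexp -> rexp -> rexp
  | RO : rexp -> rexp.

Fixpoint reval (e : rexp) : word :=
  match e with
  | RE => wempty
  | RL a => wletter a
  | RC e1 e2 => concat (reval e1) (reval e2)
  | RO e1 => womega (reval e1)
  end.

Definition rational (x : word) : Prop := exists e, weq x (reval e).

End Words.

(* Main.v *)
(* A prime word is at most each of its nonempty suffixes, and this turns any two prime words u <= v into a
   single prime power: u^s v^t is u^(s+t) if u = v, it is v^t if u^s absorbs into v (u^s v = v), and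
   otherwise u^s v is strictly smaller than v and u^s v^t is itself prime.  Repeatedly merging ascents
   hence puts any product of prime powers into decreasing form.  By induction on a rational expression
   only the omega-iteration of a decreasing product q m p (q the first and p the last factor) remains:
   (q m p)^omega = q m (p q m)^omega, and since p < q the merge of p with q gives a product with fewer
   factors, to which induction applies.  Exponents are carried as rational words over a one-letter
   alphabet; these are exactly the ordinals below omega^omega. *)
Require Import Defs.
From Stdlib Require Import List Sorted.
From Stdlib Require Import ClassicalEpsilon Morphisms.
From Stdlib Require Import Wellfounded Cantor Lia Arith.
Import ListNotations.
Set Implicit Arguments.

Local Infix "==" := weq (at level 70).
Local Infix "**" := Defs.concat (at level 40, left associativity).

Definition nonempty A (x : word A) : Prop := exists i : wcar x, True.

(** Exponents are words over the one-letter type [unit]: concatenation, [womega] and [weq] then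
    serve as sum, multiplication by omega and equality of ordinals, and lemmas on words apply to
    exponents. *)
Definition pow A (u : word A) (t : word unit) : word A := wpow u (word_ord t).

Definition oword (a : ord) : word unit := Word (olt a) (fun _ => tt).

(** A factor of [x] is given by the set [P] of its positions; [wsuffix x g] is by conversion the
    case where [P i] is [~ wlt x i g]. *)
Definition sub A (x : word A) (P : wcar x -> Prop) : word A :=
  Word (fun i j : {i | P i} => wlt x (proj1_sig i) (proj1_sig j))
       (fun i => wlab x (proj1_sig i)).

Ltac split_wo := refine (conj _ (conj _ (conj _ (conj _ _)))).

(** * Isomorphisms of words *)

Section Isomorphisms.
Variable A : Type.
Implicit Types x y z : word A.

Lemma wlt_trans x : is_word x -> forall i j k, wlt x i j -> wlt x j k -> wlt x i k.
Proof. now intros [H _]. Qed.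

Lemma wlt_irrefl x : is_word x -> forall i, ~ wlt x i i.
Proof. now intros (_ & H & _). Qed.

Lemma wlt_total x : is_word x -> forall i j, wlt x i j \/ i = j \/ wlt x j i.
Proof. now intros (_ & _ & H & _). Qed.

Lemma wlt_wf x : is_word x -> well_founded (wlt x).
Proof. now intros (_ & _ & _ & H & _). Qed.

Lemma wlt_asym x : is_word x -> forall i j, wlt x i j -> ~ wlt x j i.
Proof. intros H i j H1 H2. exact (wlt_irrefl H _ (wlt_trans H _ _ _ H1 H2)). Qed.

Lemma wlt_min x : is_word x -> forall P : wcar x -> Prop, (exists i, P i) ->
  exists i, P i /\ forall j, wlt x j i -> ~ P j.
Proof.
  intros H P [i Hi]. revert Hi. induction i as [i IH] using (well_founded_ind (wlt_wf H)).
  intros Hi. destruct (classic (exists j, wlt x j i /\ P j)) as [[j [H1 H2]]|N]; [eauto|].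
  exists i. split; auto. intros j H1 H2. apply N. eauto.
Qed.

(** Trichotomy in [x] makes a strictly increasing surjection injective and order-reflecting; its
    inverse comes from choice. *)
Lemma weq_intro x y (f : wcar x -> wcar y) : is_word x -> is_word y ->
  (forall i j, wlt x i j -> wlt y (f i) (f j)) ->
  (forall j, exists i, f i = j) ->
  (forall i, wlab y (f i) = wlab x i) -> x == y.
Proof.
  intros Hx Hy Hm Hs Hl.
  pose (g := fun j => proj1_sig (constructive_indefinite_description _ (Hs j))).
  assert (Hg : forall j, f (g j) = j)
    by (intros j; exact (proj2_sig (constructive_indefinite_description _ (Hs j)))).
  assert (Hr : forall i j, wlt y (f i) (f j) -> wlt x i j).
  { intros i j H. destruct (wlt_total Hx i j) as [?|[<-|N]]; auto.
    - now apply (wlt_irrefl Hy) in H.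
    - now apply Hm, (wlt_asym Hy) in N. }
  exists f, g. repeat split; auto.
  intros i. destruct (wlt_total Hx (g (f i)) i) as [N|[?|N]]; auto;
    apply Hm in N; rewrite Hg in N; now apply (wlt_irrefl Hy) in N.
Qed.

Lemma weq_refl x : x == x.
Proof. exists (fun i => i), (fun i => i). repeat split; auto. Qed.

Lemma weq_sym x y : x == y -> y == x.
Proof.
  intros (f & g & H1 & H2 & H3 & H4). exists g, f. repeat split; auto; intros.
  - apply H3. now rewrite !H2.
  - rewrite <- (H2 x0), <- (H2 y0). now apply H3.
  - now rewrite <- H4, H2.
Qed.

Lemma weq_trans x y z : x == y -> y == z -> x == z.
Proof.
  intros (f & g & H1 & H2 & H3 & H4) (f' & g' & K1 & K2 & K3 & K4).
  exists (fun i => f' (f i)), (fun i => g (g' i)). repeat split; intros.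
  - now rewrite K1.
  - now rewrite H2.
  - now apply K3, H3.
  - now apply H3, K3.
  - now rewrite K4.
Qed.

Global Instance weq_equiv : Equivalence (@weq A).
Proof. split; red; eauto using weq_refl, weq_sym, weq_trans. Qed.

End Isomorphisms.

(** * Closure properties of words, congruences, restriction and Levi's lemma *)

Section Words.
Variable A : Type.
Implicit Types x y z : word A.

Lemma is_word_weq x y : x == y -> is_word x -> is_word y.
Proof.
  intros H. apply weq_sym in H. destruct H as (f & g & H1 & H2 & H3 & H4).
  intros (Ht & Hi & Hc & Hw & h & Hh). cbn in *.
  split_wo; cbn; intros.
  - apply H3. apply H3 in H, H0. eauto.
  - intros N. apply H3 in N. now apply Hi in N.
  - destruct (Hc (f x0) (f y0)) as [N|[N|N]].
    + left. now apply H3.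
    + right; left. now rewrite <- (H1 x0), N, H1.
    + right; right. now apply H3.
  - apply (wf_incl _ _ (fun a b => wlt x (f a) (f b))).
    + intros a b. apply H3.
    + now apply wf_inverse_image.
  - exists (fun a => h (f a)). intros a b N. apply Hh in N. now rewrite <- (H1 a), N, H1.
Qed.

Global Instance is_word_proper : Proper (@weq A ==> iff) (@is_word A).
Proof. intros x y H. split; apply is_word_weq; auto using weq_sym. Qed.

Lemma is_word_empty : is_word (wempty A).
Proof.
  split_wo; cbn; try now intros [].
  exists (fun _ => 0). intros [].
Qed.

Lemma is_word_letter a : is_word (@wletter A a).
Proof.
  split_wo; cbn; try tauto.
  - intros [] []; auto.
  - intros i. constructor. intros j [].
  - exists (fun _ => 0). now intros [] [].
Qed.

Lemma is_word_sub x P : is_word x -> is_word (@sub A x P).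
Proof.
  intros H. pose proof H as (Ht & Hi & Hc & Hw & h & Hh). cbn in *.
  assert (E : forall i j : {i | P i}, proj1_sig i = proj1_sig j -> i = j).
  { intros [i Pi] [j Pj]; cbn. intros <-. f_equal. apply proof_irrelevance. }
  split_wo; cbn; intros; eauto.
  - destruct (Hc (proj1_sig x0) (proj1_sig y)) as [?|[?|?]]; auto.
  - now apply wf_inverse_image.
  - exists (fun a => h (proj1_sig a)). auto.
Qed.

Lemma is_word_concat x y : is_word x -> is_word y -> is_word (x ** y).
Proof.
  intros (Ht & Hi & Hc & Hw & h & Hh) (Ht' & Hi' & Hc' & Hw' & h' & Hh'). cbn in *.
  split_wo; cbn.
  - intros [i|i] [j|j] [k|k]; cbn; eauto; tauto.
  - intros [i|i]; cbn; auto.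
  - intros [i|i] [j|j]; cbn; auto.
    + destruct (Hc i j) as [?|[->|?]]; auto.
    + destruct (Hc' i j) as [?|[->|?]]; auto.
  - assert (L : forall i, Acc (concat_lt x y) (inl i)).
    { intros i. induction i as [i IH] using (well_founded_ind Hw).
      constructor. intros [j|j]; cbn; [auto|tauto]. }
    intros [i|i]; auto.
    induction i as [i IH] using (well_founded_ind Hw').
    constructor. intros [j|j]; cbn; auto.
  - exists (fun p => match p with inl i => 2 * h i | inr j => S (2 * h' j) end).
    intros [i|i] [j|j] E; try lia; f_equal; [apply Hh|apply Hh']; lia.
Qed.

Lemma is_word_pow x t : is_word x -> is_word t -> is_word (pow x t).
Proof.
  intros (Ht & Hi & Hc & Hw & h & Hh) (Ht' & Hi' & Hc' & Hw' & h' & Hh'). cbn in *.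
  split_wo; cbn.
  - intros [a i] [b j] [c k]; cbn. intros [?|[-> ?]] [?|[-> ?]]; eauto.
  - intros [a i]; cbn. intros [N|[_ N]]; [now apply Hi' in N|now apply Hi in N].
  - intros [a i] [b j]; cbn. destruct (Hc' a b) as [?|[->|?]]; auto.
    destruct (Hc i j) as [?|[->|?]]; auto.
  - intros [a i]. revert i. induction a as [a IH] using (well_founded_ind Hw').
    intros i. induction i as [i IHi] using (well_founded_ind Hw).
    constructor. intros [b j]; cbn. intros [?|[-> ?]]; auto.
  - exists (fun p => Cantor.to_nat (h' (fst p), h (snd p))).
    intros [a i] [b j] E.
    apply Cantor.to_nat_inj in E. injection E as E1 E2.
    f_equal; auto.
Qed.

(** [womega x] is by conversion [pow x omega_word], so facts on powers transfer to
    omega-iterations. *)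
Definition omega_word : word unit := Word lt (fun _ => tt).

Lemma is_word_omega_word : is_word omega_word.
Proof.
  split_wo; cbn; try lia.
  - apply lt_wf.
  - now exists (fun n => n).
Qed.

Lemma is_word_womega x : is_word x -> is_word (womega x).
Proof. intros H. exact (is_word_pow H is_word_omega_word). Qed.

Global Instance concat_proper : Proper (@weq A ==> @weq A ==> @weq A) (@Defs.concat A).
Proof.
  intros x x' (f & g & H1 & H2 & H3 & H4) y y' (f' & g' & K1 & K2 & K3 & K4).
  exists (fun p => match p with inl i => inl (f i) | inr i => inr (f' i) end),
         (fun p => match p with inl i => inl (g i) | inr i => inr (g' i) end).
  repeat split.
  - intros [i|i]; congruence.
  - intros [i|i]; congruence.
  - destruct x0 as [i|i], y0 as [j|j]; cbn; try tauto; rewrite ?H3, ?K3; tauto.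
  - destruct x0 as [i|i], y0 as [j|j]; cbn; try tauto; rewrite ?H3, ?K3; tauto.
  - intros [i|i]; cbn; auto.
Qed.

Global Instance pow_proper : Proper (@weq A ==> @weq unit ==> @weq A) (@pow A).
Proof.
  intros x x' (f & g & H1 & H2 & H3 & H4) y y' (f' & g' & K1 & K2 & K3 & K4).
  exists (fun p => (f' (fst p), f (snd p))), (fun p => (g' (fst p), g (snd p))).
  split; [intros [i j]; cbn; congruence|].
  split; [intros [i j]; cbn; congruence|].
  split; [|intros [i j]; cbn; auto].
  intros [i j] [k l]; cbn. rewrite (H3 j l). setoid_rewrite (K3 i k).
  assert (E : i = k <-> f' i = f' k); [|tauto].
  split; [congruence|]. intros E. now rewrite <- (K1 i), E.
Qed.

Global Instance womega_proper : Proper (@weq A ==> @weq A) (@womega A).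
Proof. intros x x' H. exact (pow_proper H (weq_refl omega_word)). Qed.

Lemma concat_assoc x y z : x ** (y ** z) == x ** y ** z.
Proof.
  exists (fun p => match p with inl i => inl (inl i) | inr (inl i) => inl (inr i) | inr (inr i) => inr i end),
         (fun p => match p with inl (inl i) => inl i | inl (inr i) => inr (inl i) | inr i => inr (inr i) end).
  repeat split.
  - now intros [i|[i|i]].
  - now intros [[i|i]|i].
  - destruct x0 as [i|[i|i]], y0 as [j|[j|j]]; cbn; auto.
  - destruct x0 as [i|[i|i]], y0 as [j|[j|j]]; cbn; auto.
  - now intros [i|[i|i]].
Qed.

Lemma concat_empty_l x y : ~ nonempty x -> x ** y == y.
Proof.
  intros H.
  assert (F : wcar x -> False) by (intros i; apply H; now exists i).
  exists (fun p => match p with inl i => match F i with end | inr i => i end), inr.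
  repeat split.
  - intros [i|i]; [destruct (F i)|auto].
  - destruct x0 as [i|i]; [destruct (F i)|]. destruct y0 as [j|j]; [destruct (F j)|auto].
  - destruct x0 as [i|i]; [destruct (F i)|]. destruct y0 as [j|j]; [destruct (F j)|auto].
  - intros [i|i]; [destruct (F i)|auto].
Qed.

Lemma concat_empty_r x y : ~ nonempty y -> x ** y == x.
Proof.
  intros H.
  assert (F : wcar y -> False) by (intros i; apply H; now exists i).
  exists (fun p => match p with inr i => match F i with end | inl i => i end), inl.
  repeat split.
  - intros [i|i]; [auto|destruct (F i)].
  - destruct x0 as [i|i]; [|destruct (F i)]. destruct y0 as [j|j]; [auto|destruct (F j)].
  - destruct x0 as [i|i]; [|destruct (F i)]. destruct y0 as [j|j]; [auto|destruct (F j)].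
  - intros [i|i]; [auto|destruct (F i)].
Qed.

Lemma weq_empty x y : ~ nonempty x -> ~ nonempty y -> x == y.
Proof. intros Hx Hy. now rewrite <- (concat_empty_r x Hy), (concat_empty_l y Hx). Qed.

Lemma nonempty_wempty : ~ nonempty (wempty A).
Proof. now intros [[] _]. Qed.

Lemma nonempty_letter a : nonempty (@wletter A a).
Proof. now exists tt. Qed.

Global Instance nonempty_proper : Proper (@weq A ==> iff) (@nonempty A).
Proof.
  intros x y (f & g & _). split; intros [i _]; [now exists (f i)|now exists (g i)].
Qed.

Lemma nonempty_concat x y : nonempty (x ** y) <-> nonempty x \/ nonempty y.
Proof.
  split.
  - intros [[i|i] _]; [left|right]; now exists i.
  - intros [[i _]|[i _]]; [now exists (inl i)|now exists (inr i)].
Qed.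

Lemma nonempty_pow x t : nonempty (pow x t) <-> nonempty x /\ nonempty t.
Proof.
  split.
  - intros [[k i] _]. split; [now exists i|now exists k].
  - intros [[i _] [k _]]. now exists (k, i).
Qed.

(** The way to recognize [y] as a factor of [x]: an increasing map is automatically an isomorphism
    onto its image, here described by [P]. *)
Lemma weq_sub_image x y (f : wcar y -> wcar x) (P : wcar x -> Prop) :
  is_word x -> is_word y ->
  (forall i j, wlt y i j -> wlt x (f i) (f j)) ->
  (forall i, wlab x (f i) = wlab y i) ->
  (forall k, P k <-> exists i, f i = k) -> y == sub x P.
Proof.
  intros Hx Hy Hm Hl HP.
  assert (K : forall i, P (f i)) by (intros i; apply HP; eauto).
  apply (@weq_intro A y (sub x P) (fun i => exist P (f i) (K i))); cbn; auto.
  - now apply is_word_sub.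
  - intros [k Pk]. destruct (proj1 (HP k) Pk) as [i <-]. exists i.
    f_equal. apply proof_irrelevance.
Qed.

Lemma sub_split x (P : wcar x -> Prop) : is_word x ->
  (forall i j, wlt x i j -> P j -> P i) ->
  x == sub x P ** sub x (fun i => ~ P i).
Proof.
  intros Hx HP. symmetry.
  apply (@weq_intro A (sub x P ** sub x (fun i => ~ P i)) x
    (fun p => match p with inl i => proj1_sig i | inr i => proj1_sig i end)); auto.
  - apply is_word_concat; now apply is_word_sub.
  - intros [[i Pi]|[i Pi]] [[j Pj]|[j Pj]]; cbn; try tauto. intros _.
    destruct (wlt_total Hx i j) as [?|[->|N]]; auto; [tauto|].
    destruct Pj. eauto.
  - intros j. destruct (classic (P j)) as [Pj|Pj].
    + now exists (inl (exist _ j Pj)).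
    + now exists (inr (exist (fun i => ~ P i) j Pj)).
  - now intros [[i Pi]|[i Pi]].
Qed.

Lemma cut_at x p s : is_word x -> is_word p -> is_word s -> x == p ** s -> nonempty s ->
  exists g, p == sub x (fun i => wlt x i g) /\ s == wsuffix x g.
Proof.
  intros Hx Hp Hs E [s1 _].
  (* The cut [g] will be the image of the first position [s0] of [s]. *)
  destruct (wlt_min Hs (fun _ => True) (ex_intro _ s1 I)) as [s0 [_ Hm]].
  assert (Hm' : forall i, i = s0 \/ wlt s s0 i).
  { intros i. destruct (wlt_total Hs i s0) as [N|[?|?]]; auto. now apply Hm in N. }
  destruct (weq_sym E) as (f & g & H1 & H2 & H3 & H4).
  exists (f (inr s0)). split.
  - apply (@weq_sub_image x p (fun i => f (inl i))); auto.
    + intros i j H. now apply H3.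
    + intros k. split.
      * intros H. rewrite <- (H2 k) in H. apply H3 in H.
        destruct (g k) as [i|i] eqn:Ek; cbn in H; [exists i; now rewrite <- Ek|].
        now apply Hm in H.
      * intros [i <-]. now apply H3.
  - apply (@weq_sub_image x s (fun i => f (inr i))); auto.
    + intros i j H. now apply H3.
    + intros k. split.
      * intros H. destruct (g k) as [i|i] eqn:Ek.
        -- destruct H. rewrite <- (H2 k), Ek. now apply H3.
        -- exists i. now rewrite <- Ek.
      * intros [i <-] N. apply H3 in N. now apply Hm in N.
Qed.

(** The half of Levi's lemma in which the isomorphism [f] sends [x] into [x']: its image [P] is an
    initial segment of [x'], and [t] is the remainder. *)
Lemma levi_half x y x' y' (f : wcar (x ** y) -> wcar (x' ** y')) :
  is_word x -> is_word y -> is_word x' -> is_word y' -> x ** y == x' ** y' ->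
  (forall i j, concat_lt x y i j <-> concat_lt x' y' (f i) (f j)) ->
  (forall j, exists i, f i = j) ->
  (forall i, wlab (x' ** y') (f i) = wlab (x ** y) i) ->
  (forall i, exists j, f (inl i) = inl j) ->
  exists t, is_word t /\ x' == x ** t /\ y == t ** y'.
Proof.
  intros Hx Hy Hx' Hy' E Hm Hs Hl Hi.
  assert (W : is_word (x ** y)) by now apply is_word_concat.
  assert (W' : is_word (x' ** y')) by now apply is_word_concat.
  pose (u := fun j => proj1_sig (constructive_indefinite_description _ (Hi j))).
  assert (Hu : forall i, f (inl i) = inl (u i))
    by (intros i; exact (proj2_sig (constructive_indefinite_description _ (Hi i)))).
  set (P := fun j => exists i, u i = j).
  assert (D : forall i j, wlt x' i j -> P j -> P i).
  { intros i j H [k <-]. destruct (Hs (inl i)) as [[l|l] El].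
    - exists l. rewrite Hu in El. congruence.
    - assert (N : concat_lt x' y' (f (inr l)) (f (inl k))) by now rewrite El, Hu.
      now apply Hm in N. }
  assert (E1 : x == sub x' P).
  { apply (@weq_sub_image x' x u); auto.
    - intros i j H. assert (K : concat_lt x' y' (f (inl i)) (f (inl j))) by now apply Hm.
      now rewrite !Hu in K.
    - intros i. specialize (Hl (inl i)). now rewrite Hu in Hl.
    - intros k. reflexivity. }
  exists (sub x' (fun i => ~ P i)). split; [now apply is_word_sub|]. split.
  - rewrite E1 at 1. now apply sub_split.
  - assert (K : forall j, exists i : wcar (sub x' (fun i => ~ P i) ** y'), f (inr j) =
      match i with inl i => inl (proj1_sig i) | inr i => inr i end).
    { intros j. destruct (f (inr j)) as [i|i] eqn:Ef; [|now exists (inr i)].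
      assert (N : ~ P i).
      { intros [k <-]. rewrite <- Hu in Ef.
        assert (C : concat_lt x y (inl k) (inr j)) by exact I.
        apply Hm in C. rewrite Ef in C. now apply (wlt_irrefl W') in C. }
      now exists (inl (exist (fun i => ~ P i) i N)). }
    pose (h := fun j => proj1_sig (constructive_indefinite_description _ (K j))).
    assert (Hh : forall j, f (inr j) = match h j with inl i => inl (proj1_sig i) | inr i => inr i end)
      by (intros i; exact (proj2_sig (constructive_indefinite_description _ (K i)))).
    apply (@weq_intro A y (sub x' (fun i => ~ P i) ** y') h); auto.
    + apply is_word_concat; auto. now apply is_word_sub.
    + intros i j H.
      assert (C : concat_lt x' y' (f (inr i)) (f (inr j))) by now apply Hm.
      rewrite !Hh in C. now destruct (h i), (h j).
    + intros j. destruct (Hs (match j with inl i => inl (proj1_sig i) | inr i => inr i end)) as [[k|k] Ek].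
      * rewrite Hu in Ek. destruct j as [[j Nj]|j]; cbn in Ek; [|congruence].
        destruct Nj. exists k. congruence.
      * exists k. rewrite Hh in Ek. destruct (h k) as [[i Ni]|i], j as [[j Nj]|j]; cbn in *; try congruence.
        injection Ek as ->. repeat f_equal. apply proof_irrelevance.
    + intros i. specialize (Hl (inr i)). rewrite Hh in Hl. now destruct (h i).
Qed.

Lemma levi x y x' y' : is_word x -> is_word y -> is_word x' -> is_word y' ->
  x ** y == x' ** y' ->
  (exists t, is_word t /\ x' == x ** t /\ y == t ** y') \/
  (exists t, is_word t /\ x == x' ** t /\ y' == t ** y).
Proof.
  intros Hx Hy Hx' Hy' E. pose proof E as (f & g & H1 & H2 & H3 & H4).
  destruct (classic (forall i, exists j, f (inl i) = inl j)) as [K|K].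
  - left. apply levi_half with f; eauto.
  (* Some position of [x] lands in [y'], so the inverse [g] sends all of [x'] into [x]. *)
  - right. pose proof (weq_sym E) as E'. apply not_all_ex_not in K. destruct K as [i K].
    destruct (f (inl i)) as [j|j] eqn:Ef; [now destruct K; exists j|].
    apply levi_half with g; eauto.
    + intros a b. rewrite (H3 (g a) (g b)), !H2. reflexivity.
    + intros a. now rewrite <- H4, H2.
    + intros a. destruct (g (inl a)) as [b|b] eqn:Eg; [eauto|].
      assert (N : concat_lt x' y' (inl a) (inr j)) by exact I.
      rewrite <- Ef, <- (H2 (inl a)), Eg in N. now apply H3 in N.
Qed.

(** From [f i < i] monotonicity gives [f (f i) < f i], and so on: an infinite descent. *)
Lemma mono_expansive x (f : wcar x -> wcar x) : is_word x ->
  (forall i j, wlt x i j -> wlt x (f i) (f j)) -> forall i, ~ wlt x (f i) i.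
Proof.
  intros H Hf i. induction i as [i IH] using (well_founded_ind (wlt_wf H)).
  intros N. apply (IH (f i)); auto.
Qed.

(** The copy of [x] inside [r x t] gives an increasing self-map of [x] whose values all lie below
    the image of any position [c] of [t]; that image would be moved down. *)
Lemma no_proper_embedding x r t : is_word x -> x == r ** (x ** t) -> ~ nonempty t.
Proof.
  intros H E [c _]. destruct (weq_sym E) as (f & g & H1 & H2 & H3 & H4).
  apply (@mono_expansive x (fun i => f (inr (inl i))) H) with (i := f (inr (inr c))).
  - intros i j K. now apply H3.
  - now apply H3.
Qed.

Lemma split_at x i : is_word x ->
  x == sub x (fun j => wlt x j i) ** (wletter (wlab x i) ** sub x (wlt x i)).
Proof.
  intros H. symmetry.
  apply (@weq_intro A (sub x (fun j => wlt x j i) ** (wletter (wlab x i) ** sub x (wlt x i))) x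
    (fun p => match p with inl j => proj1_sig j | inr (inl _) => i | inr (inr j) => proj1_sig j end)); auto.
  - auto using is_word_concat, is_word_sub, is_word_letter.
  - pose proof (wlt_trans H) as T.
    intros [[j Pj]|[[]|[j Pj]]] [[k Pk]|[[]|[k Pk]]]; cbn; try tauto; eauto.
  - intros j. destruct (wlt_total H i j) as [K|[<-|K]].
    + now exists (inr (inr (exist _ j K))).
    + now exists (inr (inl tt)).
    + now exists (inl (exist (fun j => wlt x j i) j K)).
  - now intros [[j Pj]|[[]|[j Pj]]].
Qed.

Lemma first_letter x : is_word x -> nonempty x ->
  exists a x', is_word x' /\ x == wletter a ** x'.
Proof.
  intros H [i0 _]. destruct (wlt_min H (fun _ => True) (ex_intro _ i0 I)) as [i [_ Hi]].
  exists (wlab x i), (sub x (wlt x i)). split; [now apply is_word_sub|].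
  rewrite (split_at i H) at 1. apply concat_empty_l. intros [[j Hj] _]. now apply Hi in Hj.
Qed.

End Words.

#[global] Hint Resolve is_word_concat is_word_sub is_word_letter is_word_empty
  is_word_pow is_word_womega is_word_omega_word nonempty_letter nonempty_wempty : word.

Ltac word := auto 10 with word.

(** * Cancellation and the lexicographic order *)

Section Cancellation.
Variable A : Type.
Implicit Types x y z : word A.

Lemma no_proper_extension x t : is_word x -> x == x ** t -> ~ nonempty t.
Proof.
  intros H E. apply (@no_proper_embedding A x (wempty A) t); auto.
  rewrite concat_empty_l; word.
Qed.

Lemma concat_cancel_l p x y : is_word p -> is_word x -> is_word y ->
  p ** x == p ** y -> x == y.
Proof.
  intros Hp Hx Hy E.
  destruct (levi Hp Hx Hp Hy E) as [(t & Ht & E1 & E2)|(t & Ht & E1 & E2)];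
    apply no_proper_extension in E1; auto; now rewrite E2, concat_empty_l.
Qed.

Lemma letter_concat (a : A) t s : wletter a == t ** s -> nonempty t -> ~ nonempty s.
Proof.
  intros (f & g & H1 & H2 & H3 & H4) [i _] [j _].
  assert (E : g (inl i) = g (inr j)) by now destruct (g (inl i)), (g (inr j)).
  apply (f_equal f) in E. rewrite !H2 in E. discriminate.
Qed.

(** A nonempty [t] cannot be a proper prefix of a letter, so Levi's lemma places the letter inside
    [t]. *)
Lemma letter_prefix (a : A) z t v : is_word z -> is_word t -> is_word v ->
  wletter a ** z == t ** v -> nonempty t ->
  exists t', is_word t' /\ t == wletter a ** t' /\ z == t' ** v.
Proof.
  intros Hz Ht Hv E N.
  destruct (levi (is_word_letter a) Hz Ht Hv E) as [H|(s & Hs & E1 & E2)]; auto.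
  pose proof (letter_concat E1 N) as Ns.
  exists (wempty A). rewrite concat_empty_r in E1 by auto.
  rewrite concat_empty_l in E2 by auto.
  rewrite concat_empty_r, concat_empty_l; word. auto using weq_sym with word.
Qed.

Lemma letter_inj (a b : A) z z' : is_word z -> is_word z' ->
  wletter a ** z == wletter b ** z' -> a = b.
Proof.
  intros Hz Hz' E.
  destruct (letter_prefix Hz (is_word_letter b) Hz' E) as (t & Ht & E1 & _); word.
  pose proof (letter_concat E1 (nonempty_letter a)) as Ns.
  rewrite concat_empty_r in E1 by auto.
  destruct E1 as (f & _ & _ & _ & _ & H). exact (H tt).
Qed.

End Cancellation.

(** * The longest common prefix of two words *)

Section Bisimulation.
Variable A : Type.

(* [match_pos x y i j]: the closed initial segments of [x] and [y] ending at [i] and [j] coincide. *)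
Inductive match_pos (x y : word A) (i : wcar x) (j : wcar y) : Prop :=
  match_pos_intro :
    wlab x i = wlab y j ->
    (forall i', wlt x i' i -> exists j', wlt y j' j /\ match_pos x y i' j') ->
    (forall j', wlt y j' j -> exists i', wlt x i' i /\ match_pos x y i' j') ->
    match_pos x y i j.

(** If [j < j'] both match [i], then [j] also matches some [i' < i], which in turn matches some
    [k < j]; the induction hypothesis at [i'] gives [k = j], a contradiction. *)
Lemma match_pos_fun x y : is_word x -> is_word y ->
  forall i j j', match_pos x y i j -> match_pos x y i j' -> j = j'.
Proof.
  intros Hx Hy i. induction i as [i IH] using (well_founded_ind (wlt_wf Hx)).
  assert (K : forall j j', match_pos x y i j -> match_pos x y i j' -> ~ wlt y j j').
  { intros j j' [_ H1 _] [_ _ H2] N. destruct (H2 _ N) as (i' & Hi & M).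
    destruct (H1 _ Hi) as (k & Hk & M'). rewrite (IH _ Hi _ _ M' M) in Hk.
    now apply (wlt_irrefl Hy) in Hk. }
  intros j j' M M'. destruct (wlt_total Hy j j') as [N|[?|N]]; auto; exfalso;
    [exact (K _ _ M M' N)|exact (K _ _ M' M N)].
Qed.

(** Both sides are the longest common prefix, cut out of [x] and of [y]; the isomorphism sends each
    position to its unique partner. *)
Lemma match_pos_weq x y : is_word x -> is_word y ->
  sub x (fun i => exists j, match_pos x y i j) == sub y (fun j => exists i, match_pos x y i j).
Proof.
  intros Hx Hy.
  set (P := fun i => exists j, match_pos x y i j).
  pose (f := fun i : {i | P i} =>
    proj1_sig (constructive_indefinite_description _ (proj2_sig i))).
  assert (Hf : forall i, match_pos x y (proj1_sig i) (f i))
    by (intros i; exact (proj2_sig (constructive_indefinite_description _ (proj2_sig i)))).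
  apply (@weq_sub_image A y (sub x P) f); word.
  - intros i i' N. destruct (Hf i') as [_ H _]. destruct (H _ N) as (j & Hj & M).
    now rewrite (match_pos_fun Hx Hy (Hf i) M).
  - intros i. now destruct (Hf i).
  - intros j. split.
    + intros [i M]. exists (exist P i (ex_intro _ j M)).
      exact (match_pos_fun Hx Hy (Hf (exist P i _)) M).
    + intros [i <-]. eexists. apply Hf.
Qed.

Lemma initial_lt (x : word A) (P : wcar x -> Prop) i0 : is_word x ->
  (forall i j, wlt x i j -> P j -> P i) -> ~ P i0 -> (forall j, wlt x j i0 -> ~ ~ P j) ->
  sub x P == sub x (fun i => wlt x i i0).
Proof.
  intros Hx D N M.
  apply (@weq_sub_image A x (sub x P) (@proj1_sig _ _)); word.
  intros k. split.
  - intros H. exists (exist P k (NNPP _ (M _ H))). reflexivity.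
  - intros [[i Pi] <-]; cbn. destruct (wlt_total Hx i i0) as [?|[->|K]]; auto; [tauto|].
    destruct N. eauto.
Qed.

End Bisimulation.

(** * The lexicographic order *)

Section Lexicographic.
Variables (A : Type) (ltA : A -> A -> Prop).
Hypothesis HA : strict_total_order ltA.
Implicit Types x y z : word A.
Local Notation "x <s y" := (str_lt ltA x y) (at level 70).

Global Instance str_lt_proper : Proper (@weq A ==> @weq A ==> iff) (str_lt ltA).
Proof.
  enough (H : forall x x' y y', x == x' -> y == y' -> str_lt ltA x y -> str_lt ltA x' y').
  { intros x x' E y y' E'. split; apply H; auto using weq_sym. }
  intros x x' y y' E E' (p & z & z' & a & b & H).
  exists p, z, z', a, b. now rewrite <- E, <- E'.
Qed.

(** The longest common prefix either exhausts one of the words, which is then a prefix of the other,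
    or is followed in both by letters that differ. *)
Lemma word_cases x y : is_word x -> is_word y ->
  (exists t, is_word t /\ y == x ** t) \/ (exists t, is_word t /\ x == y ** t) \/
  x <s y \/ y <s x.
Proof.
  intros Hx Hy. pose proof (match_pos_weq Hx Hy) as E.
  set (P := fun i => exists j, match_pos x y i j) in *.
  set (Q := fun j => exists i, match_pos x y i j) in *.
  assert (DP : forall i j, wlt x i j -> P j -> P i).
  { intros i j N [k [_ H _]]. destruct (H _ N) as (j' & _ & M). now exists j'. }
  assert (DQ : forall i j, wlt y i j -> Q j -> Q i).
  { intros i j N [k [_ _ H]]. destruct (H _ N) as (j' & _ & M). now exists j'. }
  assert (F : forall z (R : wcar z -> Prop), is_word z -> (forall i, R i) -> z == sub z R).
  { intros z R Hz HR. apply (@weq_sub_image A z z (fun i => i)); auto.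
    intros k. split; eauto. }
  destruct (classic (forall i, P i)) as [HP|HP].
  { left. exists (sub y (fun j => ~ Q j)). split; word.
    rewrite (F x P), E by auto. now apply sub_split. }
  destruct (classic (forall i, Q i)) as [HQ|HQ].
  { right; left. exists (sub x (fun j => ~ P j)). split; word.
    rewrite (F y Q), <- E by auto. now apply sub_split. }
  apply not_all_ex_not, (wlt_min Hx) in HP. destruct HP as (i0 & NP & MP).
  apply not_all_ex_not, (wlt_min Hy) in HQ. destruct HQ as (j0 & NQ & MQ).
  rewrite (initial_lt P i0 Hx DP NP MP), (initial_lt Q j0 Hy DQ NQ MQ) in E.
  pose proof (split_at i0 Hx) as Ex. pose proof (split_at j0 Hy) as Ey. rewrite <- E in Ey.
  (* Equal letters at [i0] and [j0] would make these two positions match. *)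
  assert (L : ltA (wlab x i0) (wlab y j0) \/ ltA (wlab y j0) (wlab x i0)).
  { destruct HA as (_ & _ & T). destruct (T (wlab x i0) (wlab y j0)) as [?|[El|?]]; auto.
    exfalso. apply NP. exists j0. constructor; auto.
    - intros i Hi. destruct (NNPP _ (MP _ Hi)) as [j M]. exists j. split; auto.
      destruct (wlt_total Hy j j0) as [?|[->|K]]; auto; destruct NQ.
      + now exists i.
      + apply (DQ _ _ K). now exists i.
    - intros j Hj. destruct (NNPP _ (MQ _ Hj)) as [i M]. exists i. split; auto.
      destruct (wlt_total Hx i i0) as [?|[->|K]]; auto; exfalso; apply NP.
      + now exists j.
      + apply (DP _ _ K). now exists j. }
  right; right. destruct L as [L|L]; [left|right];
    eexists _, _, _, _, _; (split; [|split; [|split; [|split; [exact L|split; eassumption]]]]; word).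
Qed.

Lemma str_lt_append x y t t' : is_word t -> is_word t' -> x <s y -> x ** t <s y ** t'.
Proof.
  intros Ht Ht' (p & z & z' & a & b & Hp & Hz & Hz' & Hab & E1 & E2).
  exists p, (z ** t), (z' ** t'), a, b. rewrite E1, E2, !concat_assoc. do 4 (split; [now word|]).
  split; reflexivity.
Qed.

Lemma str_lt_append_r x y t : is_word t -> x <s y -> x <s y ** t.
Proof.
  intros Ht H. apply (@str_lt_append x y (wempty A) t) in H; word.
  rewrite (concat_empty_r x) in H; word.
Qed.

Lemma str_lt_prepend p x y : is_word p -> x <s y -> p ** x <s p ** y.
Proof.
  intros Ht (q & z & z' & a & b & Hp & Hz & Hz' & Hab & E1 & E2).
  exists (p ** q), z, z', a, b. rewrite E1, E2, !concat_assoc. do 4 (split; [now word|]).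
  split; reflexivity.
Qed.

Lemma str_lt_irrefl x : ~ x <s x.
Proof.
  intros (p & z & z' & a & b & Hp & Hz & Hz' & Hab & E1 & E2).
  rewrite E1 in E2. apply concat_cancel_l in E2; word. apply letter_inj in E2; auto.
  subst. destruct HA as (_ & I & _). now apply I in Hab.
Qed.

(** Levi's lemma compares the places where [x] differs from [y] and [y] from [z]: the earlier one
    decides, and if they coincide the letters satisfy [a < b = c < d]. *)
Lemma str_lt_trans x y z : x <s y -> y <s z -> x <s z.
Proof.
  intros (p & r & r' & a & b & Hp & Hr & Hr' & Hab & E1 & E2).
  intros (q & s & s' & c & d & Hq & Hs & Hs' & Hcd & F1 & F2).
  rewrite E1, F2. rewrite E2 in F1.
  assert (W1 : is_word (wletter b ** r')) by word.
  assert (W2 : is_word (wletter c ** s)) by word.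
  destruct (levi Hp W1 Hq W2 F1) as [(t & Ht & G1 & G2)|(t & Ht & G1 & G2)];
  destruct (classic (nonempty t)) as [N|N].
  - destruct (letter_prefix Hr' Ht W2 G2 N) as (t' & Ht' & G3 & _).
    exists p, r, (t' ** (wletter d ** s')), a, b. rewrite G1, G3, !concat_assoc.
    do 4 (split; [now word|]). split; reflexivity.
  - rewrite (concat_empty_l _ N) in G2. rewrite (concat_empty_r _ N) in G1.
    apply letter_inj in G2; auto; subst.
    exists p, r, s', a, d. rewrite G1. destruct HA as (T & _).
    do 3 (split; [now word|]). split; [exact (T _ _ _ Hab Hcd)|]. split; reflexivity.
  - destruct (letter_prefix Hs Ht W1 G2 N) as (t' & Ht' & G3 & _).
    exists q, (t' ** (wletter a ** r)), s', c, d. rewrite G1, G3, !concat_assoc.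
    do 4 (split; [now word|]). split; reflexivity.
  - rewrite (concat_empty_l _ N) in G2. rewrite (concat_empty_r _ N) in G1.
    apply letter_inj in G2; auto; subst.
    exists p, r, s', a, d. rewrite G1. destruct HA as (T & _).
    do 3 (split; [now word|]). split; [exact (T _ _ _ Hab Hcd)|]. split; reflexivity.
Qed.

Lemma str_lt_not_prefix_r x t : is_word t -> ~ x ** t <s x.
Proof. intros Ht N. apply (str_lt_append_r Ht), str_lt_irrefl in N. auto. Qed.

Global Instance lex_le_proper : Proper (@weq A ==> @weq A ==> iff) (lex_le ltA).
Proof.
  intros x x' E y y' E'. unfold lex_le, wprefix. rewrite E, E'. setoid_rewrite E. setoid_rewrite E'.
  reflexivity.
Qed.

Lemma lex_le_refl x y : x == y -> lex_le ltA x y.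
Proof. intros ->. left. exists (wempty A). split; word. rewrite concat_empty_r; word. reflexivity. Qed.

Lemma lex_le_trans x y z : is_word x -> is_word y ->
  lex_le ltA x y -> lex_le ltA y z -> lex_le ltA x z.
Proof.
  intros Hx Hy [(t & Ht & E)|L] [(t' & Ht' & E')|L'].
  - left. exists (t ** t'). split; word. now rewrite E', E, concat_assoc.
  (* Here [x] is a prefix of [y]: if [y] and [z] first differ beyond [x], then [x] is a prefix of
     [z]; otherwise the same difference separates [x] from [z]. *)
  - destruct L' as (q & s & s' & c & d & Hq & Hs & Hs' & Hcd & F1 & F2).
    assert (W : is_word (wletter c ** s)) by word.
    rewrite E in F1. destruct (levi Hx Ht Hq W F1) as [(r & Hr & G1 & G2)|(r & Hr & G1 & G2)].
    + left. exists (r ** (wletter d ** s')). split; word. rewrite F2, G1, !concat_assoc. reflexivity.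
    + destruct (classic (nonempty r)) as [N|N].
      * right. destruct (letter_prefix Hs Hr Ht G2 N) as (r' & Hr' & G3 & _).
        exists q, r', s', c, d. rewrite G1, F2, G3. do 4 (split; [now word|]). split; reflexivity.
      * rewrite (concat_empty_r _ N) in G1.
        left. exists (wletter d ** s'). split; word. now rewrite F2, G1.
  - right. rewrite E'. now apply str_lt_append_r.
  - right. eapply str_lt_trans; eauto.
Qed.

Lemma lex_le_str_absurd x y : lex_le ltA x y -> ~ y <s x.
Proof.
  intros [(t & Ht & E)|L] N.
  - rewrite E in N. now apply str_lt_not_prefix_r in N.
  - now apply (str_lt_irrefl (str_lt_trans L N)).
Qed.

Lemma lex_le_antisym x y : is_word x -> lex_le ltA x y -> lex_le ltA y x -> x == y.
Proof.
  intros Hx H1 H2. destruct (H1) as [(t & Ht & E)|L]; [|now apply lex_le_str_absurd in L].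
  destruct H2 as [(t' & Ht' & E')|L]; [|now apply (lex_le_str_absurd H1) in L].
  rewrite E, <- concat_assoc in E'. apply no_proper_extension in E'; auto.
  rewrite nonempty_concat in E'. rewrite E, concat_empty_r; [reflexivity|tauto].
Qed.

Lemma lex_le_total x y : is_word x -> is_word y -> lex_le ltA x y \/ lex_gt ltA x y.
Proof.
  intros Hx Hy. destruct (classic (lex_le ltA x y)) as [?|N]; auto. right. split.
  - destruct (word_cases Hx Hy) as [L|[L|[L|L]]]; try (destruct N; now (left + right)); now (left + right).
  - intros E. apply N. now apply lex_le_refl.
Qed.

Lemma lex_gt_trans x y z : is_word x -> is_word y -> is_word z ->
  lex_gt ltA x y -> lex_gt ltA y z -> lex_gt ltA x z.
Proof.
  intros Hx Hy Hz [L N] [L' N']. split.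
  - exact (lex_le_trans Hz Hy L' L).
  - intros E. rewrite E in L. apply N'. now apply lex_le_antisym.
Qed.

End Lexicographic.

Local Notation one := (wletter tt).

(** * Powers and prime words *)

Section Powers.
Variable A : Type.
Implicit Types u x y z : word A.

Lemma pow_concat u (s t : word unit) : pow u (s ** t) == pow u s ** pow u t.
Proof.
  exists (fun p => match fst p with inl k => inl (k, snd p) | inr k => inr (k, snd p) end),
         (fun p => match p with inl q => (inl (fst q), snd q) | inr q => (inr (fst q), snd q) end).
  split; [now intros [[k|k] i]|].
  split; [now intros [[k i]|[k i]]|].
  split; [|now intros [[k|k] i]].
  intros [[k|k] i] [[l|l] j]; cbn; intuition congruence.
Qed.

Lemma pow_one u : pow u one == u.
Proof.
  exists (fun p => snd p), (fun i => (tt, i)).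
  split; [now intros [[] i]|]. split; auto.
  split; auto. intros [[] i] [[] j]; cbn. tauto.
Qed.

Lemma pow_womega u (t : word unit) : pow u (womega t) == womega (pow u t).
Proof.
  exists (fun p => (fst (fst p), (snd (fst p), snd p))), (fun p => ((fst p, fst (snd p)), snd (snd p))).
  split; [now intros [[n k] i]|]. split; [now intros [n [k i]]|].
  split; auto. intros [[n k] i] [[m l] j]; cbn; intuition congruence.
Qed.

Lemma nonempty_womega x : nonempty (womega x) <-> nonempty x.
Proof. split; [intros [[n i] _]; now exists i|intros [i _]; now exists (0, i)]. Qed.

(** Each copy of [y] is regrouped with the copy of [x] that follows it. *)
Lemma womega_rotate x y : womega (x ** y) == x ** womega (y ** x).
Proof.
  exists (fun p => match p with
           | (0, inl i) => inl i
           | (S n, inl i) => inr (n, inr i)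
           | (n, inr i) => inr (n, inl i) end),
         (fun p => match p with
           | inl i => (0, inl i)
           | inr (n, inr i) => (S n, inl i)
           | inr (n, inl i) => (n, inr i) end).
  split; [now intros [[|n] [i|i]]|]. split; [now intros [i|[[|n] [i|i]]]|].
  split; [|now intros [[|n] [i|i]]].
  intros [[|n] [i|i]] [[|m] [j|j]]; cbn; intuition (try lia).
Qed.

(** The first position of [s] lies in one copy of [u], with index [k]: [t1] and [t2] index the
    copies before and after it, and [y z] splits this copy. Only [z] is sure to be nonempty. *)
Lemma pow_cut u (t : word unit) p s :
  is_word u -> is_word t -> is_word p -> is_word s -> pow u t == p ** s -> nonempty s ->
  exists t1 t2 y z, is_word t1 /\ is_word t2 /\ is_word y /\ is_word z /\ nonempty z /\
    t == t1 ** (one ** t2) /\ u == y ** z /\ p == pow u t1 ** y /\ s == z ** pow u t2.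
Proof.
  intros Hu Ht Hp Hs E N.
  destruct (cut_at (is_word_pow Hu Ht) Hp Hs E N) as ([k i] & Ep & Es).
  set (t1 := sub t (fun l => wlt t l k)). set (t2 := sub t (wlt t k)).
  set (y := sub u (fun j => wlt u j i)). set (z := sub u (fun j => ~ wlt u j i)).
  exists t1, t2, y, z.
  do 4 (split; [unfold t1, t2, y, z; word|]).
  split.
  { now exists (exist (fun j => ~ wlt u j i) i (wlt_irrefl Hu i)). }
  split.
  { rewrite (split_at k Ht) at 1. destruct (wlab t k). reflexivity. }
  split.
  { apply sub_split; auto. intros a b; now apply wlt_trans. }
  rewrite Ep, Es. split; symmetry.
  - apply (@weq_sub_image A (pow u t) (pow u t1 ** y) (fun q => match q with
      | inl q => (proj1_sig (fst q), snd q) | inr j => (k, proj1_sig j) end)).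
    + word.
    + unfold t1, y; word.
    + intros [[[l Hl] j]|[j Hj]] [[[l' Hl'] j']|[j' Hj']]; cbn; auto; try tauto.
      intros [H|[H1 H2]]; auto. right. injection H1; auto.
    + now intros [[[l Hl] j]|[j Hj]].
    + intros [l j]; cbn. split.
      * intros [H|[-> H]].
        -- now exists (inl (exist (fun l => wlt t l k) l H, j)).
        -- now exists (inr (exist (fun j => wlt u j i) j H)).
      * intros [[[[l' Hl] j']|[j' Hj]] H]; cbn in H; injection H; intros; subst; auto.
  - apply (@weq_sub_image A (pow u t) (z ** pow u t2) (fun q => match q with
      | inr q => (proj1_sig (fst q), snd q) | inl j => (k, proj1_sig j) end)).
    + word.
    + unfold t2, z; word.
    + intros [[j Hj]|[[l Hl] j]] [[j' Hj']|[[l' Hl'] j']]; cbn; auto; try tauto.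
      intros [H|[H1 H2]]; auto. right. injection H1; auto.
    + now intros [[j Hj]|[[l Hl] j]].
    + intros [l j]; cbn. split.
      * intros H. destruct (wlt_total Ht l k) as [K|[->|K]]; [tauto| |].
        -- assert (Hj : ~ wlt u j i) by tauto.
           now exists (inl (exist (fun j => ~ wlt u j i) j Hj)).
        -- now exists (inr (exist (wlt t k) l K, j)).
      * intros [[[j' Hj]|[[l' Hl] j']] H]; cbn in H; injection H; intros; subst; intros [K|[K1 K2]]; auto.
        -- now apply (wlt_irrefl Ht) in K.
        -- now apply (wlt_asym Ht) in K.
        -- subst. now apply (wlt_irrefl Ht) in Hl.
Qed.

(* A tail of an ordinal is at most that ordinal, hence also an initial segment of it. *)
Lemma ordinal_tail (t t1 t2 : word unit) : is_word t1 -> is_word t2 -> t == t1 ** t2 ->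
  exists r, is_word r /\ t == t2 ** r.
Proof.
  intros H1 H2 E. assert (Ht : is_word t) by (rewrite E; word).
  (* Over one letter with the empty order [str_lt] never holds, so of two ordinals one is a prefix
     of the other. *)
  assert (T : strict_total_order (fun _ _ : unit => False))
    by (repeat split; try tauto; now intros [] []; auto).
  destruct (word_cases T Ht H2) as [(r & Hr & F)|[?|[L|L]]]; auto.
  - assert (N : ~ nonempty r).
    { apply (@no_proper_embedding _ t t1 r); auto. now rewrite <- F. }
    exists (wempty unit). split; word.
    rewrite concat_empty_r, F, concat_empty_r; word. reflexivity.
  - destruct L as (?&?&?&?&?&L); tauto.
  - destruct L as (?&?&?&?&?&L); tauto.
Qed.

End Powers.

(** * Prime words and products of two prime powers *)

Section Primes.
Variables (A : Type) (ltA : A -> A -> Prop).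
Hypothesis HA : strict_total_order ltA.
Implicit Types u v w x y z : word A.
Local Notation "x <s y" := (str_lt ltA x y) (at level 70).

(** The suffix condition of [prime] over all factorizations, the trivial one included, with the
    prefix alternative of [lex_le] sharpened to equality. *)
Definition suffix_min w : Prop :=
  forall p s, is_word p -> is_word s -> w == p ** s -> nonempty s -> w == s \/ w <s s.

(** If [s = w t], then [w = p w t], which forces [t] to be empty; so [w] is a prefix of a suffix
    only by being equal to it. *)
Lemma prime_suffix_min w : is_word w -> prime ltA w -> suffix_min w.
Proof.
  intros Hw [_ H] p s Hp Hs E N.
  destruct (classic (nonempty p)) as [Np|Np].
  - destruct (cut_at Hw Hp Hs E N) as (g & Ep & Es).
    rewrite Ep in Np. destruct Np as [[i Hi] _].
    destruct (H g (ex_intro _ i Hi)) as [(t & Ht & F)|L]; rewrite Es; auto.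
    left. rewrite F. rewrite Es, F in E. apply (no_proper_embedding Hw) in E.
    now rewrite concat_empty_r.
  - left. now rewrite E, concat_empty_l.
Qed.

Lemma primitive_pow w y (t : word unit) : is_word y -> is_word t ->
  primitive w -> w == pow y t -> y == w.
Proof. intros Hy Ht H E. now destruct (H y (word_ord t) Hy Ht E). Qed.

(** The empty word is its own power with exponent 0, and 0 is not 1. *)
Lemma primitive_nonempty w : is_word w -> primitive w -> nonempty w.
Proof.
  intros Hw H. apply NNPP. intros N.
  destruct (H w (word_ord (wempty unit)) Hw (is_word_empty unit)) as [(f & g & _) _].
  - apply weq_empty; auto. change (~ nonempty (pow w (wempty unit))).
    rewrite nonempty_pow. tauto.
  - destruct (g tt).
Qed.

(* If [w = y^t] with [t > 1] is suffix-minimal, then [w] recurs as a suffix of each of its nonempty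
   suffixes; hence one nonempty suffix [s] without such a recurrence makes [w] primitive. *)
Lemma prime_intro w p s : is_word w -> is_word p -> is_word s -> suffix_min w ->
  w == p ** s -> nonempty s ->
  (forall q r, is_word q -> is_word r -> s == q ** r -> nonempty r -> ~ w == r) ->
  prime ltA w.
Proof.
  intros Hw Hp Hs Hm E N Hr. split.
  - intros y a Hy Ha F. change (is_word (oword a)) in Ha. change (w == pow y (oword a)) in F.
    set (t := oword a) in *.
    assert (Nw : nonempty (pow y t)) by (rewrite <- F, E, nonempty_concat; auto).
    rewrite nonempty_pow in Nw. destruct Nw as [Ny Nt].
    enough (G : t == one).
    { split; [|now rewrite F, G, pow_one].
      destruct G as (f & g & H1 & H2 & H3 & _). now exists f, g. }
    assert (G := E). rewrite F in G.
    destruct (pow_cut Hy Ha Hp Hs G N)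
      as (t1 & t2 & y1 & z & Ht1 & Ht2 & Hy1 & Hz & Nz & E1 & E2 & E3 & E4).
    destruct (classic (nonempty t2)) as [N2|N2].
    (* Copies of [y] remain after the cut. The suffix [y^t2] differs from [w] by [Hr], and since
       [t2] is also an initial segment of [t] it is a prefix of [w], which excludes [w <s y^t2]. *)
    + exfalso.
      assert (Nr : nonempty (pow y t2)) by (rewrite nonempty_pow; auto).
      assert (E5 : w == p ** z ** pow y t2) by now rewrite E, E4, concat_assoc.
      destruct (Hm (p ** z) (pow y t2)) as [K|K]; word.
      * now apply (Hr z (pow y t2)) in K; word.
      * rewrite concat_assoc in E1. destruct (@ordinal_tail t (t1 ** one) t2) as (r & Hr1 & E6); word.
        rewrite F, E6, pow_concat in K. apply str_lt_not_prefix_r in K; word.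
    (* The cut lies in the last copy of [y], so [y] is both a suffix and a prefix of [w];
       suffix-minimality leaves only [w = y], and then [t] is [one]. *)
    + rewrite (concat_empty_r one N2) in E1.
      destruct (first_letter Ha Nt) as ([] & r & Hr1 & E6).
      assert (E7 : w == y ** pow y r) by now rewrite F, E6, pow_concat, pow_one.
      destruct (Hm (pow y t1) y) as [K|K]; word.
      * now rewrite F, E1, pow_concat, pow_one.
      * rewrite K in E7. apply (no_proper_extension Hy) in E7.
        rewrite nonempty_pow in E7. rewrite E6, concat_empty_r; tauto || reflexivity.
      * rewrite E7 in K. apply str_lt_not_prefix_r in K; word. tauto.
  - intros g [i Hi].
    assert (G : w == sub w (fun j => wlt w j g) ** wsuffix w g).
    { apply sub_split; auto. intros a b; now apply wlt_trans. }
    assert (Hg : nonempty (wsuffix w g)).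
    { now exists (exist (fun j => ~ wlt w j g) g (wlt_irrefl Hw g)). }
    destruct (Hm (sub w (fun j => wlt w j g)) (wsuffix w g)) as [K|K]; word.
    + now apply is_word_sub.
    + now apply lex_le_refl.
    + now right.
Qed.

Lemma prime_letter a : prime ltA (wletter a).
Proof.
  split; [|now intros [] [i []]].
  intros y t Hy Ht (f & g & H1 & H2 & H3 & H4).
  destruct (f tt) as [k i] eqn:Ef.
  assert (U : forall q, q = (k, i)) by (intros q; rewrite <- (H2 q), <- Ef; now destruct (g q)).
  assert (Uk : forall l, k = l) by (intros l; specialize (U (l, i)); congruence).
  assert (Ui : forall j, i = j) by (intros j; specialize (U (k, j)); congruence).
  destruct Ht as (_ & It & _). split.
  - exists (fun _ => tt), (fun _ => k). split; [auto|]. split; [now intros []|].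
    intros l m. rewrite <- (Uk l), <- (Uk m). cbn. split; [apply It|tauto].
  - exists (fun _ => tt), (fun _ => i). split; [auto|]. split; [now intros []|]. split.
    + intros l m. rewrite <- (Ui l), <- (Ui m). cbn. split; [apply (wlt_irrefl Hy)|tauto].
    + intros l. specialize (H4 tt). rewrite Ef in H4. cbn in *. now rewrite <- (Ui l).
Qed.

(** Of the four ways in which [u^t v] and [v] can compare, two give the claim, as a prefix of [v]
    that ends in a copy of [v] is all of [v]. The other two would produce a suffix of [v] that is
    too small, or make [v] a power of [u]. *)
Lemma prime_pow_absorb u v (t : word unit) : is_word u -> is_word v -> is_word t ->
  prime ltA u -> prime ltA v -> lex_le ltA u v -> ~ u == v ->
  pow u t ** v == v \/ pow u t ** v <s v.
Proof.
  intros Hu Hv Ht Pu Pv L N.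
  pose proof (prime_suffix_min Hv Pv) as Sv.
  assert (Hut : is_word (pow u t)) by word.
  assert (Huv : is_word (pow u t ** v)) by word.
  assert (NP : forall s, is_word s -> ~ v == pow u s).
  { intros s Hs E. apply N. apply (primitive_pow Hu Hs); auto. apply Pv. }
  assert (Sv' : forall p s, is_word p -> is_word s -> v == p ** s -> nonempty s -> lex_le ltA v s).
  { intros p s Hp Hs E Ns. destruct (Sv p s) as [K|K]; auto; [now apply lex_le_refl|now right]. }
  destruct (word_cases HA Huv Hv) as [(r & Hr & E)|[(r & Hr & E)|[?|K]]]; auto.
  - assert (E' := E). rewrite <- concat_assoc in E'. apply (no_proper_embedding Hv) in E'.
    left. rewrite (concat_empty_r _ E') in E. now symmetry.
  (* Suppose [v] is a proper prefix of [u^t v]. It ends inside the last [v], leaving a suffix [q] of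
     [v] that is a proper prefix of [v], or inside [u^t], leaving a suffix [y] of [v] that is a
     prefix of [u]; if this suffix is empty, [v] is a power of [u]. *)
  - destruct (classic (nonempty r)) as [Nr|Nr]; [|left; now rewrite (concat_empty_r _ Nr) in E].
    exfalso. destruct (levi Hut Hv Hv Hr E) as [(q & Hq & E1 & E2)|(q & Hq & E1 & E2)].
    + destruct (classic (nonempty q)) as [Nq|Nq].
      * destruct (Sv (pow u t) q) as [K|K]; auto.
        -- rewrite <- K in E2. now apply (no_proper_extension Hv) in E2.
        -- rewrite E2 in K. now apply str_lt_not_prefix_r in K.
      * rewrite (concat_empty_r _ Nq) in E1. now apply NP in E1.
    + destruct (classic (nonempty q)) as [Nq|Nq].
      * destruct (pow_cut Hu Ht Hv Hq E1 Nq)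
          as (t1 & t2 & y & z & Ht1 & Ht2 & Hy & Hz & Nz & F1 & F2 & F3 & F4).
        destruct (classic (nonempty y)) as [Ny|Ny].
        -- destruct (Sv (pow u t1) y) as [K|K]; word.
           ++ apply N. apply (lex_le_antisym HA Hu); auto. left. exists z. now rewrite K.
           ++ apply (str_lt_append_r Hz) in K. rewrite <- F2 in K.
              now apply (lex_le_str_absurd HA L) in K.
        -- rewrite (concat_empty_r _ Ny) in F3. now apply NP in F3.
      * rewrite (concat_empty_r _ Nq) in E1. now apply weq_sym, NP in E1.
  (* Suppose [v] first differs from [u^t v] by a smaller letter [a]. Start a suffix of [v] where, in
     [u^t v], the last [v] or the copy of [u] containing the difference starts: it is strictly below
     [v] or [u]. *)
  - exfalso. destruct K as (p & r & r' & a & b & Hp & Hr & Hr' & Hab & E1 & E2).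
    assert (W : is_word (wletter b ** r')) by word.
    assert (W' : is_word (wletter a ** r)) by word.
    assert (Wab : wletter a ** r <s wletter b ** r').
    { exists (wempty A), r, r', a, b. do 4 (split; [now word|]).
      split; symmetry; apply concat_empty_l; word. }
    assert (Nar : forall q, nonempty (q ** (wletter a ** r))).
    { intros q. rewrite !nonempty_concat. word. }
    destruct (levi Hut Hv Hp W E2) as [(q & Hq & F1 & F2)|(q & Hq & F1 & F2)].
    + assert (K : lex_le ltA v (q ** (wletter a ** r))).
      { apply (Sv' (pow u t)); word. rewrite E1, F1. symmetry. apply concat_assoc. }
      apply (lex_le_str_absurd HA K). rewrite F2. now apply str_lt_prepend.
    + destruct (classic (nonempty q)) as [Nq|Nq].
      * destruct (letter_prefix Hr' Hq Hv F2 Nq) as (q' & Hq' & F3 & _).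
        destruct (pow_cut Hu Ht Hp Hq F1 Nq)
          as (t1 & t2 & y & z & Ht1 & Ht2 & Hy & Hz & Nz & G1 & G2 & G3 & G4).
        rewrite F3 in G4.
        destruct (letter_prefix Hq' Hz (is_word_pow Hu Ht2) G4 Nz) as (z' & Hz' & G5 & _).
        assert (K : lex_le ltA v (y ** (wletter a ** r))).
        { apply (Sv' (pow u t1)); word. rewrite E1, G3. symmetry. apply concat_assoc. }
        apply (lex_le_trans HA Hu Hv L) in K.
        apply (lex_le_str_absurd HA K). rewrite G2, G5. apply str_lt_prepend; auto.
        exists (wempty A), r, z', a, b. do 4 (split; [now word|]).
        split; symmetry; apply concat_empty_l; word.
      * rewrite (concat_empty_r _ Nq) in F1. rewrite (concat_empty_l _ Nq) in F2.
        assert (K : lex_le ltA v (wletter a ** r)).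
        { apply (Sv' p); word. rewrite nonempty_concat. word. }
        apply (lex_le_str_absurd HA K). now rewrite <- F2.
Qed.

(** A suffix of [v^t] begins with a suffix of [v], hence strictly exceeds the whole word, which
    begins with [u^s v <s v]; by [prime_intro] this also yields primitivity. A suffix starting in
    [u^s] begins with a suffix of [u], and the case where that suffix equals [u] is left to
    [prime_pow_absorb]. *)
Lemma prime_concat_pow u v (s t : word unit) : is_word u -> is_word v -> is_word s -> is_word t ->
  prime ltA u -> prime ltA v -> lex_le ltA u v -> ~ u == v ->
  pow u s ** v <s v -> nonempty t -> prime ltA (pow u s ** pow v t).
Proof.
  intros Hu Hv Hs Ht Pu Pv L N K Nt.
  pose proof (prime_suffix_min Hv Pv) as Sv.
  pose proof (prime_suffix_min Hu Pu) as Su.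
  assert (Ns : nonempty s).
  { apply NNPP. intros Ns. rewrite concat_empty_l in K; [now apply str_lt_irrefl in K|].
    rewrite nonempty_pow. tauto. }
  destruct (first_letter Ht Nt) as ([] & t0 & Ht0 & Et).
  destruct (first_letter Hs Ns) as ([] & s0 & Hs0 & Es).
  set (w := pow u s ** pow v t).
  assert (Ev : pow v t == v ** pow v t0) by now rewrite Et, pow_concat, pow_one.
  assert (Eu : pow u s == u ** pow u s0) by now rewrite Es, pow_concat, pow_one.
  assert (H1 : forall q r, is_word q -> is_word r -> pow v t == q ** r -> nonempty r -> w <s r).
  { intros q r Hq Hr E Nr.
    destruct (pow_cut Hv Ht Hq Hr E Nr)
      as (t1 & t2 & y & z & Ht1 & Ht2 & Hy & Hz & Nz & F1 & F2 & F3 & F4).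
    unfold w. rewrite Ev, concat_assoc, F4. apply str_lt_append; word.
    destruct (Sv y z) as [G|G]; auto; [now rewrite <- G|now apply (str_lt_trans HA K)]. }
  assert (Hpu : is_word (pow u s)) by word.
  assert (Hpv : is_word (pow v t)) by word.
  apply prime_intro with (p := pow u s) (s := pow v t); word.
  - unfold w; word.
  - intros p r Hp Hr E Nr.
    destruct (levi Hp Hr Hpu Hpv (weq_sym E)) as [(q & Hq & E1 & E2)|(q & Hq & E1 & E2)].
    + destruct (classic (nonempty q)) as [Nq|Nq].
      * destruct (pow_cut Hu Hs Hp Hq E1 Nq)
          as (t1 & t2 & y & z & Ht1 & Ht2 & Hy & Hz & Nz & F1 & F2 & F3 & F4).
        destruct (Su y z) as [G|G]; auto.
        (* The remainder [z] of the cut copy equals [u], so [q = u^(1+t2)]. This is also a prefix of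
           [u^s], and behind it [u^e v] is compared with [v]. *)
        -- assert (Eq : q == pow u (one ** t2)) by now rewrite F4, <- G, pow_concat, pow_one.
           destruct (@ordinal_tail s t1 (one ** t2)) as (e & He & F5); word.
           assert (Ew : w == q ** (pow u e ** v ** pow v t0)).
           { unfold w. rewrite F5 at 1. rewrite pow_concat, <- Eq, Ev, !concat_assoc. reflexivity. }
           destruct (prime_pow_absorb Hu Hv He Pu Pv L N) as [D|D].
           ++ left. now rewrite Ew, D, E2, Ev.
           ++ right. rewrite Ew, E2, Ev. apply str_lt_prepend; auto. apply str_lt_append; word.
        -- right. unfold w. rewrite Eu, E2, F4, <- !concat_assoc. apply str_lt_append; word.
      * right. rewrite (concat_empty_l _ Nq) in E2. apply (H1 (wempty A) r); word.
        rewrite concat_empty_l; word. now symmetry.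
    + right. now apply (H1 q r).
  - unfold w; reflexivity.
  - rewrite nonempty_pow. split; auto. apply primitive_nonempty; auto. apply Pv.
  - intros q r Hq Hr E Nr F. apply (H1 q r) in E; auto. rewrite <- F in E.
    now apply str_lt_irrefl in E.
Qed.

End Primes.

(** * Rational words and ordinals *)

Section Rational.
Variable A : Type.
Implicit Types x y u : word A.

Lemma rational_weq x y : x == y -> rational x -> rational y.
Proof. intros E [e H]. exists e. now rewrite <- E. Qed.

Lemma rational_concat x y : rational x -> rational y -> rational (x ** y).
Proof. intros [e H] [e' H']. exists (RC e e'). cbn. now rewrite H, H'. Qed.

Lemma rational_womega x : rational x -> rational (womega x).
Proof. intros [e H]. exists (RO e). cbn. now rewrite H. Qed.

Lemma rational_letter a : rational (@wletter A a).
Proof. exists (RL a). reflexivity. Qed.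

Lemma is_word_reval (e : rexp A) : is_word (reval e).
Proof. induction e; cbn; word. Qed.

(** Induction on the expression for [t], by [pow_concat] and [pow_womega]. *)
Lemma rational_pow u (t : word unit) : rational u -> rational t -> rational (pow u t).
Proof.
  intros Hu [e E]. eapply rational_weq; [symmetry; rewrite E; reflexivity|]. clear E t.
  induction e as [|[]|e1 IH1 e2 IH2|e IH]; cbn.
  - exists (RE A). apply weq_empty; [|apply nonempty_wempty].
    rewrite nonempty_pow. intros [_ H]. now apply nonempty_wempty in H.
  - apply (rational_weq (weq_sym (pow_one u))); auto.
  - eapply rational_weq; [symmetry; apply pow_concat|]. now apply rational_concat.
  - eapply rational_weq; [symmetry; apply pow_womega|]. now apply rational_womega.
Qed.

End Rational.

(** * Rational ordinals lie below omega^omega *)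

Section RationalOrdinals.

(** An expression for omega^n: its positions are nested tuples of [n] naturals in lexicographic
    order, and [encode] lists their entries as in [omega_pow n]. *)
Fixpoint omega_exp (n : nat) : rexp unit :=
  match n with 0 => RL tt | S n => RO (omega_exp n) end.

Fixpoint encode (n : nat) : wcar (reval (omega_exp n)) -> list nat :=
  match n with
  | 0 => fun _ => []
  | S n => fun p => fst p :: encode n (snd p)
  end.

Lemma encode_length n i : length (encode n i) = n.
Proof. induction n as [|n IH]; cbn; auto. Qed.

Lemma encode_lt n i j : wlt (reval (omega_exp n)) i j <-> lexlist (encode n i) (encode n j).
Proof.
  induction n as [|n IH]; cbn; [tauto|]. rewrite (IH (snd i) (snd j)). tauto.
Qed.

Lemma encode_surj n l : length l = n -> exists i, encode n i = l.
Proof.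
  revert l. induction n as [|n IH]; intros [|a l] H; try discriminate.
  - now exists tt.
  - injection H as H. destruct (IH l H) as [i E]. exists (a, i). cbn. now rewrite E.
Qed.

(** The image need not be an initial segment, which makes such maps easy to build; [embeds_initial]
    recovers an initial segment. *)
Definition embeds (s t : word unit) : Prop :=
  exists f : wcar s -> wcar t, forall i j, wlt s i j -> wlt t (f i) (f j).

(** If [t] were a proper prefix of [s], the embedding would restrict to an increasing self-map of
    [t] that moves some position down. *)
Lemma embeds_initial s t : is_word s -> is_word t -> embeds s t ->
  exists r, is_word r /\ t == s ** r.
Proof.
  intros Hs Ht [f Hf].
  assert (T : strict_total_order (fun _ _ : unit => False))
    by (repeat split; try tauto; now intros [] []; auto).
  destruct (word_cases T Hs Ht) as [?|[(r & Hr & E)|[L|L]]]; auto;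
    try (now destruct L as (?&?&?&?&?&L); tauto).
  assert (N : ~ nonempty r).
  { intros [c _]. destruct (weq_sym E) as (h & _ & _ & _ & H & _).
    apply (@mono_expansive _ t (fun i => f (h (inl i))) Ht) with (i := f (h (inr c))).
    - intros i j K. now apply Hf, H.
    - now apply Hf, H. }
  exists (wempty unit). split; word.
  rewrite (concat_empty_r _ N) in E. rewrite concat_empty_r; word. now symmetry.
Qed.

Lemma embeds_omega_exp s n m : n <= m -> embeds s (reval (omega_exp n)) -> embeds s (reval (omega_exp m)).
Proof.
  intros H K. induction H as [|m _ [f Hf]]; auto.
  exists (fun i => (0, f i)). cbn. auto.
Qed.

Lemma rational_embeds (e : rexp unit) : exists n, embeds (reval e) (reval (omega_exp n)).
Proof.
  induction e as [|[]|e1 [n1 H1] e2 [n2 H2]|e [n [f Hf]]].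
  - exists 0. exists (fun i : wcar (wempty unit) => match i with end). intros [].
  - exists 0. exists (fun i => i). auto.
  (* Both summands fit into omega^max; they go into copies 0 and 1 of it inside omega^(max+1). *)
  - apply (embeds_omega_exp (Nat.le_max_l n1 n2)) in H1.
    apply (embeds_omega_exp (Nat.le_max_r n1 n2)) in H2.
    destruct H1 as [f1 H1], H2 as [f2 H2]. exists (S (Nat.max n1 n2)).
    exists (fun p => match p with inl i => (0, f1 i) | inr i => (1, f2 i) end).
    intros [i|i] [j|j]; cbn; auto; tauto.
  - exists (S n). exists (fun p => (fst p, f (snd p))).
    intros [k i] [l j]; cbn. intuition.
Qed.

Lemma lt_omega_omega_rational (t : word unit) : is_word t -> rational t ->
  lt_omega_omega (word_ord t).
Proof.
  intros Ht [e E]. destruct (rational_embeds e) as [n [f Hf]]. exists n.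
  assert (M : embeds t (reval (omega_exp n))).
  { destruct E as (h & _ & _ & _ & H & _). exists (fun i => f (h i)). intros i j K. now apply Hf, H. }
  destruct (embeds_initial Ht (is_word_reval _) M) as (r & Hr & F).
  destruct (weq_sym F) as (h & g & H1 & H2 & H3 & _).
  exists (fun i => exist (fun l => length l = n) (encode n (h (inl i))) (encode_length n _)).
  split.
  - intros i j. cbn. rewrite <- encode_lt, <- H3. reflexivity.
  - intros i [l Hl]; cbn. destruct (encode_surj l Hl) as [k Ek].
    assert (Eg := H2 k). destruct (g k) as [j|c].
    + intros _. exists j. apply eq_sig_hprop; [intros; apply proof_irrelevance|].
      cbn. now rewrite Eg.
    + intros K. rewrite <- Ek, <- encode_lt, <- Eg in K. now apply H3 in K.
Qed.

End RationalOrdinals.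

(** * Factorization into decreasing prime powers *)

Section Factorization.
Variables (A : Type) (ltA : A -> A -> Prop).
Hypothesis HA : strict_total_order ltA.

Fixpoint product (l : list (word A * word unit)) : word A :=
  match l with
  | [] => wempty A
  | p :: l => pow (fst p) (snd p) ** product l
  end.

(** Exponents are nonzero, so that a first copy of the base can be split off when factors merge. *)
Record factor (p : word A * word unit) : Prop := Factor {
  factor_word : is_word (fst p);
  factor_rational : rational (fst p);
  factor_prime : prime ltA (fst p);
  factor_exp_word : is_word (snd p);
  factor_exp_rational : rational (snd p);
  factor_exp_nonempty : nonempty (snd p) }.

Local Notation decreasing l := (Sorted (lex_gt ltA) (map fst l)).

Lemma product_app l m : product (l ++ m) == product l ** product m.
Proof.
  induction l as [|p l IH]; cbn.
  - rewrite concat_empty_l; [reflexivity|apply nonempty_wempty].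
  - now rewrite IH, concat_assoc.
Qed.

(** Equal bases add their exponents, an absorbed left factor disappears, and otherwise the whole
    product is a new prime with exponent [one]. *)
Lemma factor_merge p q : factor p -> factor q -> lex_le ltA (fst p) (fst q) ->
  exists r, factor r /\ pow (fst r) (snd r) == pow (fst p) (snd p) ** pow (fst q) (snd q).
Proof.
  destruct p as [u s], q as [v t]. intros [Hu Ru Pu Hs Rs Ns] [Hv Rv Pv Ht Rt Nt] L. cbn in *.
  destruct (classic (u == v)) as [E|E].
  - exists (u, s ** t). split.
    + split; cbn; word. now apply rational_concat. rewrite nonempty_concat; auto.
    + cbn. now rewrite pow_concat, E.
  - destruct (prime_pow_absorb HA Hu Hv Hs Pu Pv L E) as [K|K].
    + exists (v, t). split; [now split|]. cbn.
      destruct (first_letter Ht Nt) as ([] & t0 & Ht0 & Et).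
      now rewrite Et, pow_concat, pow_one, concat_assoc, K.
    + exists (pow u s ** pow v t, one). split; [|cbn; apply pow_one].
      split; cbn; word.
      * auto using rational_concat, rational_pow.
      * now apply prime_concat_pow.
      * apply rational_letter.
Qed.

(** After a merge with the head the new base may be at most the next one as well, so the result is
    inserted into the tail; hence [p] is quantified after the list. *)
Lemma factor_insert l : Forall factor l -> decreasing l -> forall p, factor p ->
  exists l', Forall factor l' /\ decreasing l' /\ length l' <= S (length l) /\
    product l' == pow (fst p) (snd p) ** product l.
Proof.
  induction l as [|q l IH]; intros Hl Sl p Hp.
  - exists [p]. repeat split; cbn; auto. reflexivity.
  - inversion Hl as [|? ? Hq Hl']; subst. apply Sorted_inv in Sl as Sl'. destruct Sl' as [Sl' _].
    destruct (lex_le_total HA (factor_word Hp) (factor_word Hq)) as [L|L].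
    + destruct (factor_merge Hp Hq L) as (r & Hr & E).
      destruct (IH Hl' Sl' r Hr) as (l' & F & S & N & E').
      exists l'. cbn. do 3 (split; auto with arith). rewrite E', E, concat_assoc. reflexivity.
    + exists (p :: q :: l). split; auto. split; [constructor; auto; now constructor|].
      split; auto. reflexivity.
Qed.

Lemma factor_sort l : Forall factor l ->
  exists l', Forall factor l' /\ decreasing l' /\ length l' <= length l /\ product l' == product l.
Proof.
  induction 1 as [|p l Hp Hl (m & Hm & Sm & Nm & Em)].
  - exists []. repeat split; cbn; auto. reflexivity.
  - destruct (factor_insert Hm Sm Hp) as (l' & F & S & N & E).
    exists l'. cbn. split; auto. split; auto. split; [lia|]. now rewrite E, Em.
Qed.

(** Transitivity along [m]. In an iterated product the last factor followed by the first is thus an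
    ascent, which can be merged. *)
Lemma decreasing_last q m p : Forall factor (q :: m ++ [p]) -> decreasing (q :: m ++ [p]) ->
  lex_gt ltA (fst q) (fst p).
Proof.
  revert q. induction m as [|r m IH]; intros q F S; cbn in S; apply Sorted_inv in S as [S H];
    apply HdRel_inv in H; auto.
  inversion F as [|? ? Hq F']; subst. inversion F' as [|? ? Hr F'']; subst.
  apply Forall_app in F'' as [_ Fp]. inversion Fp as [|? ? Hp _]; subst.
  apply (lex_gt_trans HA (factor_word Hq) (factor_word Hr) (factor_word Hp)); auto.
Qed.

(** Induction on a bound [n] for the number of factors. The factors found need not be decreasing:
    those of [q m] are followed by those of the rotated iteration. *)
Lemma factor_omega n l : length l <= n -> Forall factor l -> decreasing l ->
  exists l', Forall factor l' /\ product l' == womega (product l).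
Proof.
  revert l. induction n as [|n IH]; intros l N F S.
  all: destruct l as [|q l];
    [exists []; split; auto; apply weq_empty; rewrite ?nonempty_womega; apply nonempty_wempty|].
  { cbn in N. lia. }
  (* Splits off the last factor [p]; if there is none, [q] is the only factor and its exponent is
     multiplied by omega. *)
  destruct l as [|p m _] using rev_ind.
  - inversion F as [|? ? [Hu Ru Pu Hs Rs Ns] _]; subst. exists [(fst q, womega (snd q))]. split.
    + constructor; auto. split; cbn; word. now apply rational_womega. now apply nonempty_womega.
    + cbn. rewrite !concat_empty_r by apply nonempty_wempty. apply pow_womega.
  - pose proof (@decreasing_last q m p F S) as [L _]. inversion F as [|? ? Hq F']; subst.
    apply Forall_app in F' as [Fm Fp]. inversion Fp as [|? ? Hp _]; subst.
    destruct (factor_merge Hp Hq L) as (r & Hr & Er).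
    (* [r] replaces [p q], so the sorted list has at least one factor fewer than [q m p]. *)
    destruct (@factor_sort (r :: m)) as (m' & Fm' & Sm' & Nm' & Em'); auto.
    destruct (IH m') as (l' & Fl' & El'); auto.
    { cbn in N, Nm'. rewrite length_app in N. cbn in N. lia. }
    exists ((q :: m) ++ l'). split; [apply Forall_app; auto|].
    rewrite product_app, El', Em'. cbn. rewrite Er, product_app. cbn.
    rewrite (concat_empty_r _ (@nonempty_wempty A)).
    rewrite (concat_assoc (pow (fst q) (snd q)) (product m) (pow (fst p) (snd p))),
      (womega_rotate (pow (fst q) (snd q) ** product m)).
    apply concat_proper; [reflexivity|]. apply womega_proper. symmetry. apply concat_assoc.
Qed.

Lemma factor_reval (e : rexp A) : exists l, Forall factor l /\ product l == reval e.
Proof.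
  induction e as [|a|e1 (l1 & F1 & E1) e2 (l2 & F2 & E2)|e (l & F & E)].
  - now exists [].
  - exists [(wletter a, one)]. split.
    + constructor; auto. split; cbn; word; try apply rational_letter. apply prime_letter.
    + cbn. rewrite concat_empty_r by apply nonempty_wempty. apply pow_one.
  - exists (l1 ++ l2). split; [apply Forall_app; auto|]. cbn. now rewrite product_app, E1, E2.
  (* Sorting comes first, since [factor_omega] takes a decreasing list. *)
  - destruct (factor_sort F) as (l' & F' & S' & _ & E').
    destruct (factor_omega (le_n _) F' S') as (m & Fm & Em).
    exists m. split; auto. cbn. now rewrite Em, E', E.
Qed.

End Factorization.

Theorem mainTheorem2 (A : Type) (ltA : A -> A -> Prop)
  (HAfin : finite_type A) (HAord : strict_total_order ltA)
  (x : word A) (Hx : is_word x) (Hrat : rational x) :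
  exists l : list (word A * ord),
    Sorted (lex_gt ltA) (map fst l) /\
    (forall p, In p l ->
       is_word (fst p) /\ rational (fst p) /\ prime ltA (fst p) /\
       is_countable_wo (snd p) /\ lt_omega_omega (snd p)) /\
    weq x (wprod l).
Proof.
  destruct Hrat as [e E]. destruct (factor_reval HAord e) as (l & F & El).
  destruct (factor_sort HAord F) as (m & Fm & Sm & _ & Em).
  (* Only the orders of the exponent words are kept, which turns [product] into [wprod]. *)
  exists (map (fun p => (fst p, word_ord (snd p))) m). split; [|split].
  - rewrite map_map. exact Sm.
  - intros q Hq. apply in_map_iff in Hq as ([u t] & <- & Hp).
    rewrite Forall_forall in Fm. destruct (Fm _ Hp) as [Hu Ru Pu Ht Rt _]. cbn in *.
    repeat (split; [assumption|]). now apply lt_omega_omega_rational.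
  - rewrite E, <- El, <- Em. clear. induction m as [|p m IH]; cbn; [reflexivity|]. now rewrite IH.
Qed.
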